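(* Let $\tau(n)$ be the number of T-toothpicks added at stage $n$ of the T-toothpick structure defined in the context, with $\tau(0)=0$. Then $\tau(1)=1$, $\tau(2)=3$, and for $n\ge3$, $$ \tau(n)=\frac23\left\{3^{\mathrm{wt}(n-1)}+3^{\mathrm{wt}(n-2)}\right\}+1. $$
   Context: A T-toothpick consists of three unit line segments forming a ''T'': a crossbar of length $2$ whose midpoint is called the midpoint of the T-toothpick, and a stem of length $1$ attached perpendicularly at that midpoint. It has three endpoints (the two ends of the crossbar and the free end of the stem); an endpoint is exposed if it is not the midpoint or an endpoint of any other T-toothpick. At stage $1$ place a single T-toothpick with its stem vertical and pointing downwards. At each stage $n\ge2$, at every exposed endpoint place a T-toothpick whose midpoint is at that endpoint and whose stem points away from the existing T-toothpick (the new crossbar being perpendicular to the segment ending at that point). $\mathrm{wt}(n)$ denotes the number of $1$'s in the binary expansion of $n$. *)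

(* Defs.v *)
From mathcomp Require Import all_boot all_order all_algebra finmap.
Set Implicit Arguments.
Unset Strict Implicit.
Unset Printing Implicit Defensive.
Import GRing.Theory.
Local Open Scope fset_scope.
Local Open Scope ring_scope.

(* Addition, opposite and subtraction of points are componentwise, through
   the product zmodType structure. *)
Definition point : zmodType := (int * int)%type.

Definition rot90 (v : point) : point := (- v.2, v.1).

(* A T-toothpick is given by its midpoint and by the unit vector from the
   midpoint to the free end of the stem.  The type does not force that vector
   to be a unit vector, but the process below only produces the four axis
   directions. *)
Definition toothpick : choiceType := (point * point)%type.
Definition midpoint (t : toothpick) : point := t.1.
Definition stem (t : toothpick) : point := t.2.

Definition endpoints (t : toothpick) : {fset point} :=
  [fset midpoint t + stem t;
        midpoint t + rot90 (stem t);
        midpoint t - rot90 (stem t)].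

(* For an endpoint [q] of the T-toothpick [t] of the structure [S]. *)
Definition exposed (S : {fset toothpick}) (t : toothpick) (q : point) : bool :=
  [forall u : S, (val u != t) ==>
     (q != midpoint (val u)) && (q \notin endpoints (val u))].

(* The stem of the new T-toothpick at [q] prolongs the segment of [t] that
   goes from [midpoint t] to [q]. *)
Definition sprout (t : toothpick) (q : point) : toothpick :=
  (q, q - midpoint t).

Definition new_toothpicks (S : {fset toothpick}) : {fset toothpick} :=
  [fset sprout t q | t in S, q in endpoints t & exposed S t q].

Definition first_toothpick : toothpick := ((0, 0), (0, -1)).

Fixpoint structure (n : nat) : {fset toothpick} :=
  match n with
  | 0 => fset0
  | 1 => [fset first_toothpick]
  | m.+1 => structure m `|` new_toothpicks (structure m)
  end.

Definition tau (n : nat) : nat :=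
  if n is m.+1 then #|` structure m.+1 `\` structure m| else 0%N.

(* The binary digit of [n] of rank [i] is [(n %/ 2 ^ i) %% 2]; since
   [n < 2 ^ n], all the nonzero digits have rank [i < n]. *)
Definition wt (n : nat) : nat := (\sum_(i < n) (n %/ 2 ^ i) %% 2)%N.

(* Main.v *)
(* Since a T-toothpick is placed on the free end of a segment of its parent and
   its stem prolongs that segment, T-toothpicks behave like the cells of the
   Ulam-Warburton automaton on Z^2 (a cell is born when exactly one neighbour is
   on): a cell points to its three neighbours other than its parent.

   The Ulam-Warburton cells born at time [2 k] are the doubles of those born at
   time [k], and the ones born at time [2 k + 1] are all the sprouts of the
   previous ones; taking this as a definition, the local rule follows by
   induction, and the number of cells of a half-open quadrant born at time
   [n > 0] is [3 ^ (wt n - 1)].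

   In the T-toothpick structure only the point (0, 1) above the origin is
   different: nothing points to it but its two symmetric neighbours.  So the
   half-plane y <= 0 evolves as the automaton does, while the quadrant
   x >= 1, y >= 1 is a copy of a half-open quadrant of the automaton started at
   (1, 0) one stage later, x <= -1, y >= 1 is its mirror image, and the
   half-line x = 0, y >= 1 stays empty because it is always reached from both
   sides at once.  Stage [n + 1] thus adds
   [2 * 3 ^ (wt n - 1) + 1 + 2 * 3 ^ (wt (n - 1) - 1)] T-toothpicks. *)
Require Import Defs.
From mathcomp Require Import all_boot all_order all_algebra finmap zify ring.
Set Implicit Arguments.
Unset Strict Implicit.
Unset Printing Implicit Defensive.
Import GRing.Theory.
Local Open Scope ring_scope.

(** * The Ulam-Warburton automaton *)

Definition dir (u v : int) : bool := `|u| + `|v| == 1.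

(* [uw n x y u v]: the cell (x, y) is born at time n and its parent is
   (x - u, y - v).  The origin has stem (0, 0), hence grows in all directions. *)
Inductive uw : nat -> int -> int -> int -> int -> Prop :=
| uw_origin : uw 0 0 0 0 0
| uw_even n x y u v : uw n x y u v -> uw n.*2 (x + x) (y + y) u v
| uw_odd n x y u v a b : uw n x y u v ->
    dir a b -> (a != - u) || (b != - v) -> uw n.*2.+1 (x + x + a) (y + y + b) a b.

Lemma uw_eq n n' x x' y y' u u' v v' : uw n x y u v ->
  n' = n -> x' = x -> y' = y -> u' = u -> v' = v -> uw n' x' y' u' v'.
Proof. by move=> H -> -> -> -> ->. Qed.

Lemma uw_inv n x y u v : uw n x y u v ->
  (exists k p q, [/\ uw k p q u v, n = k.*2, x = p + p & y = q + q]) \/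
  (exists k p q r s, [/\ uw k p q r s, dir u v, (u != - r) || (v != - s) &
     [/\ n = k.*2.+1, x = p + p + u & y = q + q + v]]).
Proof.
case=> [|k p q r s H|k p q r s a b H h1 h2].
- by left; exists 0%N, 0, 0; split=> //; exact: uw_origin.
- by left; exists k, p, q.
- by right; exists k, p, q, r, s.
Qed.

(** Adjacent cells have times of different parity. Below, this is what separates the times of two
    halved cells. *)
Lemma uw_parity n x y u v : uw n x y u v ->
  exists k : int, x + y + n%:Z = k + k.
Proof.
elim=> [|k i j a b _ [m e]|k i j a b c d _ [m e]]; first by exists 0.
  by exists (i + j + k%:Z); lia.
rewrite /dir => h _.
have [e1|e1] : c + d = 1 \/ c + d = -1 by lia.
  by exists (i + j + k%:Z + 1); lia.
by exists (i + j + k%:Z); lia.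
Qed.

Lemma uw_stem n x y u v : uw n x y u v ->
  dir u v \/ [/\ n = 0%N, x = 0, y = 0, u = 0 & v = 0].
Proof.
rewrite /dir; elim=> [|k i j a b _ IH|k i j a b c d _ IH]; [by right| |by left].
by case: IH => [?|[]]; [left|right; split; lia].
Qed.

Lemma dirP a b : dir a b ->
  (a = 1 /\ b = 0 \/ a = -1 /\ b = 0) \/ (a = 0 /\ b = 1 \/ a = 0 /\ b = -1).
Proof. by rewrite /dir; lia. Qed.

Lemma dir_odd a b : dir a b -> exists k : int, a + b = k + k + 1.
Proof. by case/dirP=> [] [] [-> ->]; [exists 0|exists (-1)|exists 0|exists (-1)]. Qed.

Lemma dirN a b : dir (- a) (- b) = dir a b.
Proof. by rewrite /dir; lia. Qed.

(** Unit vectors congruent modulo 2 lie on the same axis. This compares two ways of reaching a point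
    from doubled cells. *)
Lemma dir_double a b c d k l : dir a b -> dir c d -> k + k = a + c -> l + l = b + d ->
  (c = a /\ d = b) \/ (c = - a /\ d = - b).
Proof. by move=> /dirP[] [] [-> ->] /dirP[] [] [-> ->] ? ?; lia. Qed.

Lemma uw_origin_uniq n x y u v : uw n x y u v -> x = 0 -> y = 0 ->
  [/\ n = 0%N, u = 0 & v = 0].
Proof.
elim=> [|k p q r s _ IH ex ey|k p q r s a b _ _ /dirP h _ ex ey] //.
  by case: IH => [||-> ? ?] //; lia.
by lia.
Qed.

(* A cell is pointed to by its parent only, among the cells older than it. *)
Lemma uw_first n x y u v n' x' y' u' v' a b :
  uw n x y u v -> uw n' x' y' u' v' -> (n' < n)%N ->
  x = x' + a -> y = y' + b -> dir a b -> (a != - u') || (b != - v') ->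
  a = u /\ b = v.
Proof.
move=> H; elim: H n' x' y' u' v' a b => {n x y u v}
  [|n x y u v H IH|n x y u v c d H IH h1 h2] n' x' y' u' v' a b H' // lt e1 e2 h5 h6;
  case: (uw_inv H') => [[m [p [q [H2 e3 e4 e5]]]]|
    [m [p [q [r [s [H2 h3 h4 [e3 e4 e5]]]]]]]].
- have := dirP h5; lia.
- have [e|e] := @dir_double a b u' v' (x - p) (y - q) h5 h3 ltac:(lia) ltac:(lia); last lia.
  by apply: (IH _ _ _ _ _ _ _ H2) => //; lia.
(* If [(a, b) = - (c, d)], the halved older cell [(p, q)] is the neighbour [(x + c, y + d)]. By
   parity it is strictly older than [(x, y)], so induction makes [(- c, - d)] the stem of [(x, y)],
   which [h2] forbids. *)
- have [e|[e e']] := @dir_double c d a b (p - x + a) (q - y + b) h1 h5 ltac:(lia) ltac:(lia); first lia.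
  have [k ek] := uw_parity H; have [l el] := uw_parity H2.
  have h7 : dir (- c) (- d) by rewrite dirN.
  have lt' : (m < n)%N by have := dirP h5; lia.
  have [||||] := IH _ _ _ _ _ (- c) (- d) H2 lt' => //; lia.
- by have [[k ek] [l el] [m' em]] := And3 (dir_odd h5) (dir_odd h3) (dir_odd h1); lia.
Qed.

Lemma uw_inj n x y u v n' u' v' : uw n x y u v -> uw n' x y u' v' ->
  [/\ n = n', u = u' & v = v'].
Proof.
move=> H; elim: H n' u' v' => {n x y u v}
  [|n x y u v H IH|n x y u v a b H IH h1 h2] n' u' v'.
- by move=> /uw_origin_uniq[] // -> -> ->.
- case/uw_inv=> [[m [p [q [H2 e3 e4 e5]]]]|
    [m [p [q [r [s [H2 h3 h4 [e3 e4 e5]]]]]]]]; last by have := dirP h3; lia.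
  have [|e -> ->] := IH m u' v'; last by split=> //; lia.
  by apply: (uw_eq H2); lia.
- case/uw_inv=> [[m [p [q [H2 e3 e4 e5]]]]|
    [m [p [q [r [s [H2 h3 h4 [e3 e4 e5]]]]]]]]; first by have := dirP h1; lia.
  have [[e1 e2]|[e1 e2]] := @dir_double a b u' v' (p - x + u') (q - y + v') h1 h3 ltac:(lia) ltac:(lia).
    subst u' v'; have [|e _ _] := IH m r s; last by split=> //; lia.
    by apply: (uw_eq H2); lia.
  (* Two opposite sprouts meet: the halved cells are adjacent, hence of different ages. By
     [uw_first] the younger has its stem along the direction from the older, so it cannot sprout
     back. *)
  have [l el] := uw_parity H; have [l' el'] := uw_parity H2.
  have [lt|lt] : (n < m)%N \/ (m < n)%N by have := dirP h1; lia.
    have [||||] := uw_first (a:=a) (b:=b) H2 H lt => //; lia.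
  have [||||] := uw_first (a:=-a) (b:=-b) H H2 lt => //; rewrite ?dirN //; lia.
Qed.

Lemma uw_time0 n x y u v : uw n x y u v -> n = 0%N ->
  [/\ x = 0, y = 0, u = 0 & v = 0].
Proof. by elim=> [|k p q r s _ IH e|] //; case: IH => [|-> -> -> ->] //; lia. Qed.

Lemma uw_parent n x y u v : uw n.+1 x y u v ->
  dir u v /\ exists r s, uw n (x - u) (y - v) r s /\ ((u != - r) || (v != - s)).
Proof.
move=> H; have [m em] : exists m, m = n.+1 by exists n.+1.
rewrite -em in H.
elim: H n em => {m x y u v} [|m x y u v H IH|m x y u v a b H IH h1 h2] n em //.
  have lt : (m.-1.+1 = m)%N by lia.
  have [h [r [s [Hr hr]]]] := IH _ (esym lt); split=> //.
  (* The parent of a doubled cell is the sprout, in direction [(u, v)], of the doubled parent; its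
     time is [2 (m - 1) + 1 = 2 m - 1]. *)
  exists u, v; split; first by apply: (uw_eq (uw_odd Hr h hr)); lia.
  by have := dirP h; lia.
split=> //; exists u, v; split=> //.
by apply: (uw_eq (uw_even H)); lia.
Qed.

(** The midpoint is included, so the negation is the condition of [exposed] for one T-toothpick. A
    zero stem, as at the origin of the automaton, gives all four neighbours. *)
Definition touches (x y u v p q : int) : bool :=
  (p == x) && (q == y) ||
  dir (p - x) (q - y) && ((p - x != - u) || (q - y != - v)).

Lemma touchesP x y u v p q : touches x y u v p q ->
  (p = x /\ q = y) \/
  dir (p - x) (q - y) /\ ((p - x != - u) || (q - y != - v)).
Proof. by case/orP=> [/andP[/eqP ? /eqP ?]|/andP[? ?]]; [left|right]. Qed.

(** A doubled cell sprouts freely. An odd cell going straight repeats the situation of its halved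
    cell; turning, it aims at a point with two odd coordinates, at which a second odd cell aims
    too. *)
Lemma uw_grow n x y u v a b : uw n x y u v ->
  dir a b -> (a != - u) || (b != - v) ->
  uw n.+1 (x + a) (y + b) a b \/
  exists k p q r s, [/\ (k <= n)%N, uw k p q r s, (p != x) || (q != y) &
    touches p q r s (x + a) (y + b)].
Proof.
move=> H; elim: H a b => {n x y u v}
  [|n x y u v H IH|n x y u v c d H IH h1 h2] a b ha hb.
- by left; apply: (uw_eq (uw_odd uw_origin ha hb)); lia.
- by left; apply: (uw_odd H ha hb).
have [[ea eb]|neq] : (a = c /\ b = d) \/ ((a != c) || (b != d)) by lia.
  subst a b; case: (IH c d h1 h2) => [H1|[k [p [q [r [s [lk Hk hk /touchesP ht]]]]]]].
    by left; apply: (uw_eq (uw_even H1)); lia.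
  (* An obstacle of the half-scale picture is doubled if it lies at the point, and replaced by its
     sprout towards the point otherwise. *)
  right; case: ht => [[ex ey]|[h3 h4]].
    exists k.*2, (p + p), (q + q), r, s; split; [lia|exact: uw_even| |].
      by have := dirP h1; lia.
    by apply/orP; left; lia.
  have H2 := uw_odd Hk h3 h4; do 5!eexists; split; [|exact: H2| |]; [lia|lia|].
  apply/orP; right.
  have -> : x + x + c + c - (p + p + (x + c - p)) = x + c - p by ring.
  have -> : y + y + d + d - (q + q + (y + d - q)) = y + d - q by ring.
  by rewrite h3; have := dirP h3; lia.
(* The second cell next to the corner is [2 (x, y) + (a, b)]: a sprout of the doubled [(x, y)], or
   of its doubled parent when [(a, b)] points back to that parent. *)
right; have [ne|[ea eb]] : ((a != - u) || (b != - v)) \/ (a = - u /\ b = - v) by lia.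
  have H2 := uw_odd H ha ne; do 5!eexists; split; [|exact: H2| |]; [lia|lia|].
  apply/orP; right.
  have -> : x + x + c + a - (x + x + a) = c by ring.
  have -> : y + y + d + b - (y + y + b) = d by ring.
  by rewrite h1; lia.
have hu : dir u v by rewrite -dirN -ea -eb.
case: n H IH => [|n] H IH.
  by have [_ _ eu ev] := uw_time0 H (erefl _); subst u v.
have [_ [r [s [Hr hr]]]] := uw_parent H.
have H2 := uw_odd Hr hu hr; do 5!eexists; split; [|exact: H2| |]; [lia|lia|].
apply/orP; right.
have -> : x + x + c + a - (x - u + (x - u) + u) = c by rewrite ea; ring.
have -> : y + y + d + b - (y - v + (y - v) + v) = d by rewrite eb; ring.
by rewrite h1; lia.
Qed.

Lemma uw_exposed n x y u v k p q r s : uw n.+1 x y u v -> uw k p q r s ->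
  (k <= n)%N -> touches p q r s x y -> p = x - u /\ q = y - v.
Proof.
move=> H H' le /touchesP[[ex ey]|[h1 h2]].
  by subst p q; have [e _ _] := uw_inj H H'; lia.
have [|||] := uw_first H H' _ _ _ h1 h2; lia.
Qed.

(** * Symmetries, axes and adjacent rows of the automaton *)

Lemma uw_rot n x y u v : uw n x y u v -> uw n (- y) x (- v) u.
Proof.
elim=> {n x y u v} [|n x y u v _ IH|n x y u v a b _ IH h1 h2]; first exact: uw_origin.
  by apply: (uw_eq (uw_even IH)); lia.
have h : dir (- b) a by have := dirP h1; rewrite /dir; lia.
by apply: (uw_eq (uw_odd IH h _)); lia.
Qed.

Lemma uw_refl n x y u v : uw n x y u v -> uw n (- x) y (- u) v.
Proof.
elim=> {n x y u v} [|n x y u v _ IH|n x y u v a b _ IH h1 h2]; first exact: uw_origin.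
  by apply: (uw_eq (uw_even IH)); lia.
have h : dir (- a) b by have := dirP h1; rewrite /dir; lia.
by apply: (uw_eq (uw_odd IH h _)); lia.
Qed.

(** Hence no cell of row 1 points down, and the half-plane y <= 0 evolves independently of what lies
    above. *)
Lemma uw_row1 n x y u v : uw n x y u v -> y = 1 -> u = 0 /\ v = 1.
Proof.
elim=> {n x y u v} [|n x y u v _ IH|n x y u v a b _ IH h1 h2] e //; first lia.
by have := dirP h1; lia.
Qed.

Lemma uw_colN1 n x y u v : uw n x y u v -> x = -1 -> u = -1 /\ v = 0.
Proof. by move=> /uw_rot/uw_rot/uw_rot/uw_row1 h e; lia. Qed.

Lemma uw_on_axis n : exists2 u, uw n n%:Z 0 u 0 & u = (0 < n)%:Z.
Proof.
have [m] := ubnP n; elim: m n => // m IH n le.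
have [e|e] : n = n./2.*2 \/ n = n./2.*2.+1 by lia.
  case: n e le => [|n] e le; first by exists 0 => //; exact: uw_origin.
  have [u Hu eu] : exists2 u, uw (n.+1)./2 (n.+1)./2%:Z 0 u 0 & u = (0 < (n.+1)./2)%:Z.
    by apply: IH; lia.
  by exists u; [apply: (uw_eq (uw_even Hu)); lia|lia].
have [u Hu eu] : exists2 u, uw n./2 n./2%:Z 0 u 0 & u = (0 < n./2)%:Z by apply: IH; lia.
by exists 1; [apply: (uw_eq (uw_odd (a := 1) (b := 0) Hu _ _)) => //; lia|lia].
Qed.

Lemma uw_axis n x u v : uw n x 0 u v -> 0 <= x ->
  [/\ x = n%:Z, u = (0 < n)%:Z & v = 0].
Proof.
case: x => // m H _; have [w Hw ew] := uw_on_axis m.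
have [-> -> ->] := uw_inj H Hw; split=> //.
Qed.

(** * The T-toothpick structure in terms of the automaton *)

(* Times are shifted: [ttp n] describes what stage [n + 1] adds. *)
Inductive ttp : nat -> int -> int -> int -> int -> Prop :=
| ttp_first : ttp 0 0 0 0 (-1)
| ttp_lower n x y u v : uw n.+1 x y u v -> y <= 0 -> ttp n.+1 x y u v
| ttp_right n x y u v : uw n x y u v -> 1 <= y -> 0 <= x -> ttp n.+1 (x + 1) y u v
| ttp_left n x y u v : uw n x y u v -> 1 <= y -> x <= 0 -> ttp n.+1 (x - 1) y u v.

Lemma ttp_eq n n' x x' y y' u u' v v' : ttp n x y u v ->
  n' = n -> x' = x -> y' = y -> u' = u -> v' = v -> ttp n' x' y' u' v'.
Proof. by move=> H -> -> -> -> ->. Qed.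

Lemma ttp_mirror n x y u v : ttp n x y u v -> ttp n (- x) y (- u) v.
Proof.
case=> {n x y u v} [|n x y u v /uw_refl H h|n x y u v /uw_refl H h1 h2|n x y u v /uw_refl H h1 h2].
- exact: ttp_first.
- exact: ttp_lower.
- by apply: (ttp_eq (ttp_left H h1 _)); lia.
- by apply: (ttp_eq (ttp_right H h1 _)); lia.
Qed.

Lemma ttp_inv n x y u v : ttp n x y u v ->
  (n = 0%N /\ x = 0 /\ y = 0 /\ u = 0 /\ v = -1 \/ (0 < n)%N /\ y <= 0 /\ uw n x y u v) \/
  ((0 < n)%N /\ 1 <= y /\ 1 <= x /\ uw n.-1 (x - 1) y u v \/
   (0 < n)%N /\ 1 <= y /\ x <= -1 /\ uw n.-1 (x + 1) y u v).
Proof.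
case=> {n x y u v} [|n x y u v H h|n x y u v H h1 h2|n x y u v H h1 h2].
- by left; left.
- by left; right.
- by right; left; do 3!(split; first lia); apply: (uw_eq H) => //; lia.
- by right; right; do 3!(split; first lia); apply: (uw_eq H) => //; lia.
Qed.

Lemma ttp_dir n x y u v : ttp n x y u v -> dir u v.
Proof.
case=> {n x y u v} [|n x y u v H h|n x y u v H h1 h2|n x y u v H h1 h2] //;
  by case: (uw_stem H) => // -[]; lia.
Qed.

Lemma ttp_inj n x y u v n' u' v' : ttp n x y u v -> ttp n' x y u' v' ->
  [/\ n = n', u = u' & v = v'].
Proof.
case/ttp_inv=> [] [] H; case/ttp_inv=> [] [] H'; try lia; last 2 first.
- case: H => n0 [h1 [h2 H]]; case: H' => n0' [_ [_ H']].
  by have [e -> ->] := uw_inj H H'; split=> //; lia.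
- case: H => n0 [h1 [h2 H]]; case: H' => n0' [_ [_ H']].
  by have [e -> ->] := uw_inj H H'; split=> //; lia.
- by split; lia.
- case: H => -> [-> [-> [-> ->]]] in H' *; case: H' => ? [? H'].
  by have [||? ? ?] := uw_origin_uniq H'; lia.
- case: H' => -> [ex [ey [-> ->]]]; case: H => ? [? H].
  by have [||? ? ?] := uw_origin_uniq H; lia.
- by case: H => ? [? H]; case: H' => ? [? H']; apply: uw_inj H H'.
Qed.

(** The stems are quantified on each side because those at the origin differ, [(0, -1)] against
    [(0, 0)]. This only affects the point (0, 1), which [q <= 0] excludes. *)
Lemma touched_lower n (x y p q : int) : q <= 0 ->
  (exists u v, ttp n x y u v /\ touches x y u v p q) <->
  (exists u v, uw n x y u v /\ touches x y u v p q).
Proof.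
move=> hq; split=> -[u [v [H /touchesP h]]].
  case/ttp_inv: H => [] [].
  - move=> [en [ex [ey [eu ev]]]]; subst n x y; exists 0, 0; split; first exact: uw_origin.
    by rewrite /touches; case: h => [|[hd hn]]; [lia|]; rewrite hd; have := dirP hd; lia.
  - by move=> [n0 [hy H]]; exists u, v; split=> //; rewrite /touches; lia.
  - move=> [n0 [hy [hx H]]]; case: h => [|[hd hn]]; first lia.
    by have := dirP hd => hd'; have := uw_row1 H; lia.
  - move=> [n0 [hy [hx H]]]; case: h => [|[hd hn]]; first lia.
    by have := dirP hd => hd'; have := uw_row1 H; lia.
have hy : y <= 0.
  case: h => [|[hd hn]]; first lia.
  by have := dirP hd => hd'; have := uw_row1 H; lia.
case: n H => [|n] H.
  have [ex ey eu ev] := uw_time0 H (erefl _); exists 0, (-1); subst x y u v.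
  split; first exact: ttp_first.
  by rewrite /touches; case: h => [|[hd hn]]; [lia|]; rewrite hd; have := dirP hd; lia.
by exists u, v; split; [exact: ttp_lower|rewrite /touches; lia].
Qed.

(** The bottom boundary agrees as well: the cell [(n + 1, 0)] of the lower half-plane plays the part
    of [(n, 0)], up to a stem that differs only for [n = 0]. Nothing enters from the left: by
    [uw_colN1], column -1 of the automaton does not point right. *)
Lemma touched_right n (x y p q : int) : 1 <= p -> 1 <= q ->
  (exists u v, ttp n.+1 x y u v /\ touches x y u v p q) <->
  (exists u v, uw n (x - 1) y u v /\ touches (x - 1) y u v (p - 1) q).
Proof.
move=> hp hq; have ep : p - 1 - (x - 1) = p - x by ring.
split=> -[u [v [H /touchesP h]]].
  case/ttp_inv: H => [] [].
  - by lia.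
  - move=> [n0 [hy H]]; case: h => [|[hd hn]]; first lia.
    have := dirP hd => hd'.
    have ? : y = 0 by lia.
    subst y; have [|ex eu ev] := uw_axis H; first by lia.
    have [w Hw ew] := uw_on_axis n; exists w, 0; split; first by apply: (uw_eq Hw) => //; lia.
    by rewrite /touches ep hd; lia.
  - by move=> [n0 [hy [hx H]]]; exists u, v; split=> //; rewrite /touches ep; lia.
  - move=> [n0 [hy [hx H]]]; case: h => [|[hd hn]]; first lia.
    by have := dirP hd; lia.
rewrite ep in h.
have [hx|hx] : 1 <= x \/ x - 1 <= -1 by lia.
  have [hy|hy] : 1 <= y \/ y <= 0 by lia.
    exists u, v; split; last by rewrite /touches; lia.
    by apply: (ttp_eq (ttp_right H hy _)); lia.
  case: h => [|[hd hn]]; first lia.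
  have := dirP hd => hd'.
  have ? : y = 0 by lia.
  subst y; have [|ex eu ev] := uw_axis H; first by lia.
  have [w Hw ew] := uw_on_axis n.+1; exists w, 0; split.
    by apply: ttp_lower => //; apply: (uw_eq Hw) => //; lia.
  by rewrite /touches hd; lia.
case: h => [|[hd hn]]; first lia.
have := dirP hd => hd'.
by have := uw_colN1 H; lia.
Qed.

Lemma ttp_lowerE n (p q u v : int) : q <= 0 -> ttp n.+1 p q u v <-> uw n.+1 p q u v.
Proof.
move=> hq; split; last by move/ttp_lower; apply.
by case/ttp_inv=> [] [] ; [lia|case=> _ []|lia|lia].
Qed.

Lemma ttp_rightE n (p q u v : int) : 1 <= p -> 1 <= q -> ttp n.+1 p q u v <-> uw n (p - 1) q u v.
Proof.
move=> hp hq; split=> [|H].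
  by case/ttp_inv=> [] [] ; [lia|lia|case=> _ [_ []]|lia].
by apply: (ttp_eq (ttp_right H hq _)); lia.
Qed.

Lemma ttp_column n (y u v : int) : 1 <= y -> ~ ttp n 0 y u v.
Proof. by move=> hy /ttp_inv; lia. Qed.

(** Within the line x = 0 only the first T-toothpick comes close enough, and its stem excludes the
    point above it. Anything else arrives from the side, and its mirror image arrives with it. *)
Lemma touched_column n (x y u v q : int) : ttp n x y u v -> 1 <= q -> touches x y u v 0 q ->
  x != 0 /\ touches (- x) y (- u) v 0 q.
Proof.
move=> H hq; have [e|ne] : x = 0 \/ x != 0 by lia.
  subst x => /touchesP[[_ e]|[hd hn]].
    by subst y; case: (ttp_column hq H).
  have [hy|hy] : 1 <= y \/ y = 0 by have := dirP hd; lia.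
    by case: (ttp_column hy H).
  subst y; case/ttp_inv: H => [] [].
  - by have := dirP hd; lia.
  - move=> [n0 [_ H]]; have [|e _ _] := uw_axis H; lia.
  - lia.
  - lia.
case/touchesP=> [|[hd hn]]; first lia.
split=> //.
have ey : q = y by have := dirP hd; lia.
have ex : x = 1 \/ x = -1 by have := dirP hd; lia.
have : dir (0 - - x) (q - y) by move: hd; rewrite /dir; lia.
by rewrite /touches => ->; lia.
Qed.

Lemma touches_mirror (x y u v p q : int) :
  touches (- x) y (- u) v (- p) q = touches x y u v p q.
Proof.
rewrite /touches; have -> : dir (- p - - x) (q - y) = dir (p - x) (q - y) by rewrite /dir; lia.
by lia.
Qed.

Lemma uw_touched_parent n (x y u v : int) : uw n.+1 x y u v ->
  exists r s, uw n (x - u) (y - v) r s /\ touches (x - u) (y - v) r s x y.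
Proof.
move=> /uw_parent[hd [r [s [H h]]]]; exists r, s; split=> //.
have ex : x - (x - u) = u by ring.
have ey : y - (y - v) = v by ring.
by rewrite /touches ex ey hd h orbT.
Qed.

Lemma ttp_touched_parent n (x y u v : int) : ttp n.+1 x y u v ->
  exists r s, ttp n (x - u) (y - v) r s /\ touches (x - u) (y - v) r s x y.
Proof.
have right n' (x' y' u' v' : int) : 1 <= x' -> 1 <= y' -> ttp n'.+1 x' y' u' v' ->
    exists r s, ttp n' (x' - u') (y' - v') r s /\ touches (x' - u') (y' - v') r s x' y'.
  move=> hx hy /(ttp_rightE _ _ _ hx hy) H; case: n' H => [|n'] H.
    by case: (uw_time0 H (erefl _)); lia.
  by apply/touched_right => //; rewrite addrAC; apply: uw_touched_parent.
move=> H; case/ttp_inv: (H) => [] [] h.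
- by lia.
- case: h => _ [hy H']; have [r [s [H1 h1]]] := uw_touched_parent H'.
  by apply/touched_lower => //; exists r, s.
- by apply: right H; lia.
- have [||r [s [H1 h1]]] := right _ _ _ _ _ _ _ (ttp_mirror H); [lia|lia|].
  have ex : - x - - u = - (x - u) by ring.
  rewrite ex in H1 h1; exists (- r), s; split.
    by rewrite -(opprK (x - u)); apply: ttp_mirror.
  by rewrite -touches_mirror opprK.
Qed.

Lemma uw_touched_grow n (x y u v p q : int) : uw n x y u v -> touches x y u v p q ->
  (p != x) || (q != y) ->
  uw n.+1 p q (p - x) (q - y) \/
  exists k x' y', [/\ (k <= n)%N, (x' != x) || (y' != y) &
    exists u' v', uw k x' y' u' v' /\ touches x' y' u' v' p q].
Proof.
move=> H /touchesP[|[hd hn]]; first lia.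
move=> _; case: (uw_grow H hd hn).
  by rewrite ![_ + (_ - _)]addrC !subrK; left.
move=> [k [x' [y' [u' [v' [lk Hk h ht]]]]]]; right; exists k, x', y'; split=> //.
by exists u', v'; split=> //; move: ht; rewrite ![_ + (_ - _)]addrC !subrK.
Qed.

(** In each region this is [uw_touched_grow] transported by [touched_lower] or [touched_right]; on
    the half-line x = 0, y >= 1 the mirror image is the obstacle. *)
Lemma ttp_grow n (x y u v p q : int) : ttp n x y u v -> touches x y u v p q ->
  (p != x) || (q != y) ->
  ttp n.+1 p q (p - x) (q - y) \/
  exists k x' y', [/\ (k <= n)%N, (x' != x) || (y' != y) &
    exists u' v', ttp k x' y' u' v' /\ touches x' y' u' v' p q].
Proof.
have right n' (x' y' u' v' p' q' : int) : 1 <= p' -> 1 <= q' ->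
    ttp n' x' y' u' v' -> touches x' y' u' v' p' q' -> (p' != x') || (q' != y') ->
    ttp n'.+1 p' q' (p' - x') (q' - y') \/
    exists k x1 y1, [/\ (k <= n')%N, (x1 != x') || (y1 != y') &
      exists u1 v1, ttp k x1 y1 u1 v1 /\ touches x1 y1 u1 v1 p' q'].
  (* Time 0 has no counterpart in the delayed copy, but the first T-toothpick does not touch this
     quadrant. *)
  move=> hp hq H h ne; case: n' H => [|n'] H.
    case/ttp_inv: H => [] []; try lia.
    move=> [_ [ex [ey [eu ev]]]]; subst x' y' u' v'.
    by case/touchesP: h => [|[/dirP hd hn]]; lia.
  have /(touched_right _ _ _ hp hq)[r [s [H1 h1]]] :
    exists u v, ttp n'.+1 x' y' u v /\ touches x' y' u v p' q' by exists u', v'.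
  have [|H2|[k [x1 [y1 [lk h2 [u1 [v1 [H3 h3]]]]]]]] := uw_touched_grow H1 h1; first lia.
    left; apply/ttp_rightE => //; apply: (uw_eq H2) => //; lia.
  right; exists k.+1, (x1 + 1), y1; split; [lia|lia|].
  by apply/touched_right => //; exists u1, v1; rewrite addrK.
move=> H h ne; have [hq|hq] : q <= 0 \/ 1 <= q by lia.
  have /(touched_lower _ _ _ _ hq)[r [s [H1 h1]]] :
    exists u v, ttp n x y u v /\ touches x y u v p q by exists u, v.
  have [//|H2|[k [x1 [y1 [lk h2 [u1 [v1 [H3 h3]]]]]]]] := uw_touched_grow H1 h1.
    by left; apply/ttp_lowerE.
  by right; exists k, x1, y1; split=> //; apply/touched_lower => //; exists u1, v1.
have [hp|[hp|hp]] : 1 <= p \/ 1 <= - p \/ p = 0 by lia.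
- exact: right H h ne.
- have h' : touches (- x) y (- u) v (- p) q by rewrite touches_mirror.
  have [|H2|[k [x1 [y1 [lk h2 [u1 [v1 [H3 h3]]]]]]]] := right _ _ _ _ _ _ _ hp hq (ttp_mirror H) h'; first lia.
    by left; apply: (ttp_eq (ttp_mirror H2)); lia.
  right; exists k, (- x1), y1; split; [lia|lia|].
  exists (- u1), v1; split; first exact: ttp_mirror.
  by rewrite -touches_mirror !opprK.
- subst p; have [nx h1] := touched_column H hq h.
  right; exists n, (- x), y; split; [lia|lia|].
  by exists (- u), v; split; first exact: ttp_mirror.
Qed.

Lemma ttp_exposed n (x y u v : int) k (p q r s : int) : ttp n.+1 x y u v -> ttp k p q r s ->
  (k <= n)%N -> touches p q r s x y -> p = x - u /\ q = y - v.
Proof.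
have right n' (x' y' u' v' : int) k' (p' q' r' s' : int) : 1 <= x' -> 1 <= y' ->
    ttp n'.+1 x' y' u' v' -> ttp k' p' q' r' s' -> (k' <= n')%N ->
    touches p' q' r' s' x' y' -> p' = x' - u' /\ q' = y' - v'.
  move=> hx hy /(ttp_rightE _ _ _ hx hy) H H' le h.
  case: k' H' le => [|k'] H' le.
    case/ttp_inv: H' => [] []; try lia.
    move=> [_ [ex [ey [eu ev]]]]; subst p' q' r' s'.
    by case/touchesP: h => [|[/dirP hd hn]]; lia.
  have /(touched_right _ _ _ hx hy)[r1 [s1 [H1 h1]]] :
    exists u v, ttp k'.+1 p' q' u v /\ touches p' q' u v x' y' by exists r', s'.
  case: n' le H => // n' le H.
  by have := uw_exposed H H1 le h1; lia.
move=> H H' le h; have [hy|hy] : y <= 0 \/ 1 <= y by lia.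
  have /(touched_lower _ _ _ _ hy)[r1 [s1 [H1 h1]]] :
    exists u v, ttp k p q u v /\ touches p q u v x y by exists r, s.
  by have := uw_exposed (proj1 (ttp_lowerE _ _ _ _ hy) H) H1 le h1.
have [hx|[hx|hx]] : 1 <= x \/ 1 <= - x \/ x = 0 by lia.
- exact: right H H' le h.
- have h' : touches (- p) q (- r) s (- x) y by rewrite touches_mirror.
  by have := right _ _ _ _ _ _ _ _ _ _ hx hy (ttp_mirror H) (ttp_mirror H') le h'; lia.
- by subst x; case: (ttp_column hy H).
Qed.

(** * Agreement with the finite structure *)

Definition placed (n : nat) (t : toothpick) : Prop :=
  ttp n t.1.1 t.1.2 t.2.1 t.2.2.

Lemma dir_neq (x y u v : int) : dir u v -> (x != x - u) || (y != y - v).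
Proof. by move/dirP; lia. Qed.

Lemma in_endpoints (t : toothpick) (q : point) : dir t.2.1 t.2.2 ->
  (q \in endpoints t) =
  touches t.1.1 t.1.2 t.2.1 t.2.2 q.1 q.2 && ((q.1 != t.1.1) || (q.2 != t.1.2)).
Proof.
case: t q => [[x y] [u v]] [a b] /= /dirP h; rewrite /endpoints /midpoint /stem /rot90 !inE /= /touches.
rewrite !xpair_eqE /= /dir.
move: (x : int) (y : int) (u : int) (v : int) (a : int) (b : int) h
  => {}x {}y {}u {}v {}a {}b.
by case=> [] [] [-> ->]; lia.
Qed.

Lemma exposedP (S : {fset toothpick}) (t : toothpick) (q : point) :
  reflect (forall u, u \in S -> u != t -> (q != midpoint u) && (q \notin endpoints u))
          (exposed S t q).
Proof.
apply: (iffP forallP) => [H u uS ne|H u].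
  by have := H [` uS]%fset; rewrite /= ne.
by apply/implyP => ne; apply: H => //; exact: fsvalP.
Qed.

Lemma in_new_toothpicks (S : {fset toothpick}) (t' : toothpick) :
  (t' \in new_toothpicks S) <->
  exists t q, [/\ t \in S, q \in endpoints t, exposed S t q & t' = sprout t q].
Proof.
split.
  by case/imfset2P => t tS [q]; rewrite inE /= => /andP[h1 h2] ->; exists t, q.
move=> [t [q [tS h1 h2 ->]]]; apply/imfset2P; exists t => //; exists q => //.
by rewrite inE /= h1.
Qed.

Lemma placed_uniq n n' (t t' : toothpick) : placed n t -> placed n' t' ->
  midpoint t = midpoint t' -> n = n' /\ t = t'.
Proof.
rewrite /placed /midpoint.
case: t t' => [[x y] [u v]] [[x' y'] [u' v']] /= H H' [ex ey]; subst x' y'.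
by have [-> -> ->] := ttp_inj H H'.
Qed.

Lemma dir_placed n (t : toothpick) : placed n t -> dir t.2.1 t.2.2.
Proof. exact: ttp_dir. Qed.

(** By [ttp_grow], an endpoint without a birth has an obstacle, hence is not exposed. Conversely,
    [ttp_touched_parent] and [ttp_exposed] put every birth of time [n.+1] at an exposed endpoint of
    its parent. *)
Lemma placed_step n (S : {fset toothpick}) :
  (forall t, t \in S <-> exists2 k, (k <= n)%N & placed k t) ->
  forall t, t \in (S `|` new_toothpicks S)%fset <->
    exists2 k, (k <= n.+1)%N & placed k t.
Proof.
move=> HS t; rewrite inE; split.
  case/orP=> [/HS[k le Hk]|]; first by exists k => //; lia.
  case/in_new_toothpicks=> t1 [q [/HS[k le Hk]]].
  rewrite (in_endpoints _ (dir_placed Hk)) => /andP[h1 h2] /exposedP ex ->.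
  case: (ttp_grow Hk h1 h2) => [H|[k' [x [y [le' ne [u [v [Hu hu]]]]]]]].
    by exists k.+1.
  have ne' : ((x, y), (u, v)) != t1.
    by case: t1 ne {Hk h1 h2 ex} => [[? ?] [? ?]] /=; rewrite !xpair_eqE; lia.
  have Hp : placed k' ((x, y), (u, v)) by [].
  have inS : ((x, y), (u, v)) \in S by apply/HS; exists k' => //; lia.
  have /andP[n1 n2] := ex _ inS ne'.
  move: n1 n2; rewrite (in_endpoints _ (dir_placed Hp)) /= hu /midpoint /=.
  by case: q {h1 h2 ex hu} => a b /=; rewrite xpair_eqE /=; lia.
case=> k le Hk; have [le'|ek] : (k <= n)%N \/ k = n.+1 by lia.
  by apply/orP; left; apply/HS; exists k.
subst k; apply/orP; right; apply/in_new_toothpicks.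
have [r [s [H h]]] := ttp_touched_parent Hk.
have Hp : placed n ((t.1.1 - t.2.1, t.1.2 - t.2.2), (r, s)) by [].
set t0 : toothpick := (_, _) in Hp; exists t0, t.1.
split.
- by apply/HS; exists n.
- by rewrite (in_endpoints _ (dir_placed Hp)) [X in X && _]h dir_neq // (dir_placed Hk).
- apply/exposedP => u /HS[k lek Hu] ne; rewrite -negb_or; apply/negP => hu.
  have hu' : touches u.1.1 u.1.2 u.2.1 u.2.2 t.1.1 t.1.2.
    case/orP: hu => [/eqP e|]; first by rewrite e /touches !eqxx.
    by rewrite (in_endpoints _ (dir_placed Hu)) => /andP[].
  have [e1 e2] := ttp_exposed Hk Hu lek hu'.
  have [|_ eu] := placed_uniq Hu Hp; last by rewrite eu eqxx in ne.
  by rewrite /midpoint /= -e1 -e2; case: (u.1).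
- rewrite {}/t0 {Hk H h} in Hp *; case: t {Hp} => [[x y] [u v]] /=; rewrite /sprout /midpoint /=.
  by congr (_, (_, _)); rewrite /= opprB addrC subrK.
Qed.

Lemma structureP n (t : toothpick) :
  t \in structure n.+1 <-> exists2 k, (k <= n)%N & placed k t.
Proof.
elim: n t => [|n IH] t; last exact: placed_step.
rewrite /= inE; split=> [/eqP ->|[k]].
  by exists 0%N => //; exact: ttp_first.
rewrite leqn0 => /eqP -> H; have H0 : placed 0 first_toothpick by exact: ttp_first.
case/ttp_inv: (H) => [] []; try lia.
move=> [_ [ex [ey _]]]; have [|_ ->] := placed_uniq H H0; last exact: eqxx.
by rewrite /midpoint; move: ex ey; case: (t.1) => a b /= -> ->.
Qed.

Lemma tauE n (l : seq toothpick) : uniq l ->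
  (forall t, t \in l <-> placed n t) -> tau n.+1 = size l.
Proof.
move=> ul Hl; have -> : size l = #|` [fset t in l]%fset|.
  by rewrite card_fseq undup_id.
congr #|` _|; apply/fsetP => t; rewrite !inE.
apply/idP/idP => [/andP[h1]|].
  case/structureP=> k le Hk; apply/Hl.
  have [e|lt] : k = n \/ (k < n)%N by lia.
    by rewrite -e.
  by case: n le lt h1 {Hl} => // n le lt /negP[]; apply/structureP; exists k.
move/Hl => H; apply/andP; split; last by apply/structureP; exists n.
apply/negP; case: n H {Hl} => // n H /structureP[k le Hk].
by have [] := placed_uniq H Hk (erefl _); lia.
Qed.

(** * Counting *)

(** A free bound lets the digit sums of [n] and [n.*2] be compared term by term. *)
Lemma wt_widen n m : (n <= m)%N -> wt n = (\sum_(i < m) (n %/ 2 ^ i) %% 2)%N.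
Proof.
move=> le; rewrite /wt -(subnKC le) big_split_ord /= [X in (_ = _ + X)%N]big1 ?addn0 // => i _.
by rewrite divn_small // (leq_trans (ltn_expl n (isT : (1 < 2)%N))) // leq_exp2l // leq_addr.
Qed.

Lemma wt_double n : wt n.*2 = wt n.
Proof.
rewrite (@wt_widen _ n.*2.+1) ?leqnSn // big_ord_recl expn0 divn1 modn2 odd_double add0n.
rewrite (@wt_widen n n.*2); last by lia.
apply: eq_bigr => i _; rewrite /= /bump /= expnS divnMA.
by congr ((_ %/ _) %% _)%N; lia.
Qed.

Lemma wt_doubleS n : wt n.*2.+1 = (wt n).+1.
Proof.
rewrite /wt big_ord_recl expn0 divn1 modn2 /= odd_double /= add1n; congr _.+1.
rewrite -/(wt n) (@wt_widen n n.*2); last by lia.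
apply: eq_bigr => i _; rewrite /= /bump /= expnS divnMA.
by congr ((_ %/ _) %% _)%N; lia.
Qed.

Lemma wt_gt0 n : (0 < n)%N -> (0 < wt n)%N.
Proof.
have [m] := ubnP n; elim: m n => // m IH n le n0.
have [e|e] : n = n./2.*2 \/ n = n./2.*2.+1 by lia.
  by rewrite e wt_double; apply: IH; lia.
by rewrite e wt_doubleS.
Qed.

(** Births are given by a relation in [Prop], so they are counted by a duplicate-free
    enumeration. *)
Definition has_card (P : toothpick -> Prop) (n : nat) : Prop :=
  exists l : seq toothpick, [/\ uniq l, size l = n & forall t, t \in l <-> P t].

Lemma has_card_ext (P Q : toothpick -> Prop) n :
  has_card P n -> (forall t, Q t <-> P t) -> has_card Q n.
Proof. by move=> [l [h1 h2 h3]] h; exists l; split=> // t; rewrite h. Qed.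

Lemma has_card0 (P : toothpick -> Prop) : (forall t, ~ P t) -> has_card P 0.
Proof. by move=> h; exists [::]; split=> // t; split=> // /h. Qed.

Lemma has_card1 t : has_card (fun t' => t' = t) 1.
Proof. by exists [:: t]; split=> // t'; rewrite inE; split=> /eqP. Qed.

Lemma has_cardU (P Q : toothpick -> Prop) m n : has_card P m -> has_card Q n ->
  (forall t, P t -> ~ Q t) -> has_card (fun t => P t \/ Q t) (m + n).
Proof.
move=> [l [h1 h2 h3]] [l' [h1' h2' h3']] h; exists (l ++ l'); split.
- rewrite cat_uniq h1 h1' andbT /=; apply/hasPn => t /h3' Qt.
  by apply/negP => /h3 /h.
- by rewrite size_cat h2 h2'.
- move=> t; rewrite mem_cat; split=> [/orP[/h3|/h3']|[/h3 ->|/h3' ->]]; rewrite ?orbT //.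
    by left.
  by right.
Qed.

Lemma has_card_image (P Q : toothpick -> Prop) n (f g : toothpick -> toothpick) :
  has_card P n -> cancel f g -> cancel g f -> (forall t, Q t <-> P (g t)) -> has_card Q n.
Proof.
move=> [l [h1 h2 h3]] fK gK h; exists (map f l); split; last first.
- by move=> t; rewrite h -h3 -{1}(gK t) mem_map //; apply: can_inj fK.
- by rewrite size_map.
- by rewrite map_inj_uniq //; apply: can_inj fK.
Qed.

(** * Births of the automaton by quadrants *)

Definition uwt (n : nat) (t : toothpick) : Prop := uw n t.1.1 t.1.2 t.2.1 t.2.2.

Definition quadrant (n : nat) (t : toothpick) : Prop :=
  [/\ uwt n t, 1 <= t.1.1 & 1 <= t.1.2].

(** These are the Gaussian integers 1, i and -i: multiplying a stem by them gives every direction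
    but the one back to the parent. *)
Definition turns : seq (int * int) := [:: (1, 0); (0, 1); (0, -1)].

Definition child (t : toothpick) (c : int * int) : toothpick :=
  let d := (c.1 * t.2.1 - c.2 * t.2.2, c.2 * t.2.1 + c.1 * t.2.2) in
  (t.1 + t.1 + d, d).

Lemma child_dirs (r s u v : int) : dir r s -> dir u v -> (u != - r) || (v != - s) ->
  exists2 c, c \in turns & u = c.1 * r - c.2 * s /\ v = c.2 * r + c.1 * s.
Proof.
move=> h h' h2.
have [e|[e|e]] : (u = r /\ v = s) \/ (u = - s /\ v = r) \/ (u = s /\ v = - r).
  by move: h2; case/dirP: h => [] [] [-> ->]; case/dirP: h' => [] [] [-> ->]; lia.
- by exists (1, 0) => /=; [|lia].
- by exists (0, 1) => /=; [|lia].
- by exists (0, -1) => /=; [|lia].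
Qed.

Lemma dirs_child (r s : int) c : dir r s -> c \in turns ->
  dir (c.1 * r - c.2 * s) (c.2 * r + c.1 * s) /\
  ((c.1 * r - c.2 * s != - r) || (c.2 * r + c.1 * s != - s)).
Proof.
move=> h; rewrite !inE => /or3P[] /eqP -> /=;
by case/dirP: h => [] [] [-> ->].
Qed.

Lemma quadrant_dir n t : quadrant n t -> dir t.2.1 t.2.2.
Proof. by case=> /uw_stem[//|[_ e _ _ _]]; rewrite e. Qed.

(** The stem of a child is its displacement from the doubled parent, so it gives back the position
    of the parent, then the parent's stem by [uw_inj], then the turn. *)
Lemma child_inj n t t' c c' : quadrant n t -> quadrant n t' -> c \in turns -> c' \in turns ->
  child t c = child t' c' -> t = t' /\ c = c'.
Proof.
move=> Ht; have hd := quadrant_dir Ht; case: Ht; rewrite /uwt.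
case: t t' hd => [[p q] [r s]] [[p' q'] [r' s']] /= hd H _ _ [/= H' _ _] hc hc'.
rewrite /child /= => -[e1 e2 e3 e4].
have ep : p = p' by move: e1; rewrite e3; lia.
have eq : q = q' by move: e2; rewrite e4; lia.
subst p' q'; have [_ er es] := uw_inj H H'. rewrite /= in er es; subst r' s'; split=> //.
move: hc hc' e3 e4; rewrite !inE.
by case/or3P=> /eqP ->; case/or3P=> /eqP -> //=; case/dirP: hd => [] [] [-> ->].
Qed.

Lemma card_children n k : (0 < n)%N -> has_card (quadrant n) k ->
  has_card (fun t => exists2 t', quadrant n t' &
    exists2 c, c \in turns & t = child t' c) (k * 3).
Proof.
move=> n0 [l [h1 h2 h3]].
exists [seq child t c | t <- l, c <- turns]; split.
- apply: allpairs_uniq => // p1 p2 /allpairsP[[t c] [Ht hc ->]] /allpairsP[[t' c'] [Ht' hc' ->]].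
  by move: Ht Ht' hc hc' => /= /h3 Ht /h3 Ht' hc hc' E; have [-> ->] := child_inj Ht Ht' hc hc' E.
- by rewrite size_allpairs h2.
- move=> t; split.
    by case/allpairsP=> -[t' c] /= [/h3 i1 i2 ->]; exists t' => //; exists c.
  by case=> t' /h3 h [c hc ->]; apply/allpairsP; exists (t', c).
Qed.

Lemma double_dir_gt0 (p q a b : int) : dir a b -> 1 <= p -> 1 <= q ->
  1 <= p + p + a /\ 1 <= q + q + b.
Proof. by move=> /dirP; lia. Qed.

(** Here [k] is [3 ^ (wt n - 1) - 1], written without subtraction. Doubling time keeps [k]; from
    time [i > 0] to [2 i + 1] it becomes [3 k + 2], so [k + 1] is tripled. *)
Lemma card_quadrant n : (0 < n)%N ->
  exists2 k, has_card (quadrant n) k & (3 ^ wt n = 3 * k.+1)%N.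
Proof.
have [m] := ubnP n; elim: m n => // m IH n le n0.
have [e|e] : n = n./2.*2 \/ n = n./2.*2.+1 by lia.
  have [||k Hk ek] := IH n./2; [lia|lia|].
  exists k; last by rewrite e wt_double.
  case: Hk => l [h1 h2 h3]; exists [seq (t.1 + t.1, t.2) | t <- l]; split.
  - rewrite map_inj_uniq // => -[[x y] [u v]] [[x' y'] [u' v']] [/= ? ? -> ->].
    by congr (_, _, _); lia.
  - by rewrite size_map.
  - move=> [[x y] [u v]]; split.
      case/mapP=> [[[p q] [r s]]] /h3[/= H hp hq] [-> -> -> ->].
      by split=> /=; [rewrite e; exact: uw_even|lia|lia].
    rewrite /quadrant /uwt /= => -[H hx hy]; apply/mapP; case/uw_inv: H.
      case=> [j [p [q [H ej ex ey]]]]; exists ((p, q), (u, v)); last by rewrite ex ey.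
      apply/h3; split=> /=; [|lia|lia].
      by apply: (uw_eq H) => //; lia.
    by case=> [j [p [q [r [s [_ _ _ [ej _ _]]]]]]]; lia.
have [n1|n1] : n = 1%N \/ (0 < n./2)%N by lia.
  (* At time 1 only the four neighbours of the origin are born, all on the axes. *)
  subst n; exists 0%N; last by rewrite (wt_doubleS 0) /wt big_ord0.
  apply: has_card0 => -[[x y] [u v]]; rewrite /quadrant /uwt /= => -[/uw_inv H hx hy].
  case: H => [[j [p [q [H ej ex ey]]]]|[j [p [q [r [s [H /dirP hd _ [ej ex ey]]]]]]]]; first by lia.
  by have [|? ? ? ?] := uw_time0 H; lia.
have [||k Hk ek] := IH n./2; [lia|lia|].
exists (k * 3 + 2)%N; last by rewrite e wt_doubleS expnS ek; lia.
set i := n./2 in e n1 ek Hk *.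
(* The axis cells [(i, 0)] and [(0, i)] each send one sprout into the open quadrant. *)
have C1 := has_card1 ((i%:Z + i%:Z, 1), (0, 1)).
have C2 := has_card1 ((1, i%:Z + i%:Z), (1, 0)).
apply: (has_card_ext (has_cardU (card_children n1 Hk) (has_cardU C1 C2 _) _)) => {C1 C2}.
- by move=> t ->; case; lia.
- move=> t [t' Ht' [c hc ->]]; have hd := quadrant_dir Ht'; case: Ht'.
  case: t' hd => [[p q] [r s]] /= hd H hp hq; rewrite /child /=.
  have [/dirP hd' _] := dirs_child hd hc.
  by case=> -[] e1 e2 e3 e4; lia.
move=> [[x y] [u v]]; split.
  rewrite /quadrant /uwt /= => -[/uw_inv[]]; first by case=> [j [p [q [H ej ex ey]]]]; lia.
  case=> [j [p [q [r [s [H hd hn [ej ex ey]]]]]]] hx hy.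
  have ? : j = i by lia.
  subst j; have hd' := dirP hd.
  have [hp|hp] : 1 <= p \/ p = 0 by lia.
    have [hq|hq] : 1 <= q \/ q = 0 by lia.
      left; exists ((p, q), (r, s)); first by split.
      have [hrs|[_ ? _ _ _]] := uw_stem H; last by lia.
      have [c hc [eu ev]] := child_dirs hrs hd hn; exists c => //.
      by rewrite /child /= -eu -ev ex ey.
    right; left; subst q; have [|ep er es] := uw_axis H; first by lia.
    have [eu ev] : u = 0 /\ v = 1 by lia.
    by rewrite ex ey eu ev; congr (_, _, (_, _)); lia.
  right; right; subst p; have [|ep er es] := uw_axis (uw_rot (uw_rot (uw_rot H))); first by lia.
  have [eu ev] : u = 1 /\ v = 0 by lia.
  by rewrite ex ey eu ev; congr (_, _, (_, _)); lia.
case=> [[[[p q] [r s]] Ht [c hc ->]]|].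
  have hd := quadrant_dir Ht; case: Ht => /= H hp hq.
  have [h1 h2] := dirs_child hd hc.
  split=> /=; [rewrite /uwt /= e; exact: uw_odd H h1 h2|..].
    exact: (double_dir_gt0 h1 hp hq).1.
  exact: (double_dir_gt0 h1 hp hq).2.
have [w Hw ew] := uw_on_axis i.
case=> -[-> -> -> ->]; split=> //=; rewrite /uwt /=; try lia.
  by apply: (uw_eq (uw_odd (a := 0) (b := 1) Hw _ _)) => //; lia.
by apply: (uw_eq (uw_odd (a := 1) (b := 0) (uw_rot Hw) _ _)) => //; lia.
Qed.

Definition half_open_quadrant (n : nat) (t : toothpick) : Prop :=
  [/\ uwt n t, 0 <= t.1.1 & 1 <= t.1.2].

(** For [n > 0] the half-axis adds the single cell [(0, n)] to the open quadrant. For [n = 0] the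
    truncated quotient [1 %/ 3] is 0, rightly so since the origin lies outside the region. *)
Lemma card_half_open_quadrant n : has_card (half_open_quadrant n) (3 ^ wt n %/ 3).
Proof.
case: n => [|n].
  rewrite /wt big_ord0; apply: has_card0 => -[[x y] [u v]].
  by rewrite /half_open_quadrant /uwt /= => -[H hx hy]; case: (uw_time0 H); lia.
have [k Hk ->] := @card_quadrant n.+1 isT; rewrite mulKn // -[k.+1]addn1.
apply: (has_card_ext (has_cardU Hk (has_card1 ((0, n.+1%:Z), (0, 1))) _)).
  by move=> t [_ h _] e; move: h; rewrite e.
move=> [[x y] [u v]]; rewrite /half_open_quadrant /quadrant /uwt /=; split.
  move=> [H hx hy]; have [h|h] : 1 <= x \/ x = 0 by lia.
    by left.
  right; subst x; have [|e1 e2 e3] := uw_axis (uw_rot (uw_rot (uw_rot H))); first by lia.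
  by congr (_, _, (_, _)); lia.
case=> [[H hx hy]|[-> -> -> ->]]; first by split=> //; lia.
by split=> //; have [w Hw ew] := uw_on_axis n.+1; apply: (uw_eq (uw_rot Hw)); lia.
Qed.

Lemma card_placed n : has_card (placed n.+1)
  ((3 ^ wt n.+1 %/ 3 + 3 ^ wt n.+1 %/ 3 + 1) + (3 ^ wt n %/ 3 + 3 ^ wt n %/ 3)).
Proof.
have H1 := card_half_open_quadrant n.+1; have H2 := card_half_open_quadrant n.
(* The half-plane y <= 0 splits into the rotated copies x <= 0, y <= -1 (by [r2]) and x >= 1, y <= 0
   (by [r3]), and one cell on the left half-axis. Above it lie the delayed copies, moved by [right]
   and [left]. *)
pose r2 (t : toothpick) : toothpick := ((- t.1.1, - t.1.2), (- t.2.1, - t.2.2)).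
pose r3 (t : toothpick) : toothpick := ((t.1.2, - t.1.1), (t.2.2, - t.2.1)).
pose r1 (t : toothpick) : toothpick := ((- t.1.2, t.1.1), (- t.2.2, t.2.1)).
pose right (t : toothpick) : toothpick := ((t.1.1 + 1, t.1.2), t.2).
pose right' (t : toothpick) : toothpick := ((t.1.1 - 1, t.1.2), t.2).
pose left (t : toothpick) : toothpick := ((- t.1.1 - 1, t.1.2), (- t.2.1, t.2.2)).
have r2K : cancel r2 r2 by move=> [[x y] [u v]]; rewrite /r2 /= !opprK.
have r3K : cancel r3 r1 by move=> [[x y] [u v]]; rewrite /r1 /r3 /= !opprK.
have r1K : cancel r1 r3 by move=> [[x y] [u v]]; rewrite /r1 /r3 /= !opprK.
have rightK : cancel right right' by move=> [[x y] [u v]]; rewrite /right /right' /= addrK.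
have right'K : cancel right' right by move=> [[x y] [u v]]; rewrite /right /right' /= subrK.
have leftK : cancel left left.
  by move=> [[x y] [u v]]; rewrite /left /= !opprK; congr (_, _, _); ring.
have L1 := has_card_image H1 r2K r2K (fun=> iff_refl _).
have L2 := has_card_image H1 r3K r1K (fun=> iff_refl _).
have L3 := has_card1 ((- n.+1%:Z, 0), (-1, 0)).
have U1 := has_card_image H2 rightK right'K (fun=> iff_refl _).
have U2 := has_card_image H2 leftK leftK (fun=> iff_refl _).
apply: (has_card_ext (has_cardU (has_cardU (has_cardU L1 L2 _) L3 _) (has_cardU U1 U2 _) _));
  rewrite /half_open_quadrant /placed /uwt /r2 /r1 /right' /left.
- by move=> [[x y] [u v]] /= [_ h1 h2] [_ h3 h4]; lia.
- by move=> [[x y] [u v]] /= [] [_ h1 h2] [? ? ? ?]; lia.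
- by move=> [[x y] [u v]] /= [_ h1 h2] [_ h3 h4]; lia.
- move=> [[x y] [u v]] /= h h'.
  have hy : y <= 0 by case: h => [[] []|[]]; lia.
  by case: h' => [] []; lia.
move=> [[x y] [u v]] /=; split.
  case/ttp_inv=> [] [].
  - by lia.
  - move=> [_ [hy H]]; left.
    have [[hx hy']|[hx|[hx hy']]] : (x <= 0 /\ y <= -1) \/ 1 <= x \/ (x <= 0 /\ y = 0) by lia.
    + by left; left; split; [do 2!apply: uw_rot|lia|lia].
    + by left; right; split; [apply: uw_rot|lia|lia].
    right; subst y; have [|e1 e2 e3] := uw_axis (uw_refl H); first by lia.
    by congr (_, _, (_, _)); lia.
  - by move=> [_ [hy [hx H]]]; right; left; split=> //; lia.
  - move=> [_ [hy [hx H]]]; right; right; split=> //; last by lia.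
    by apply: (uw_eq (uw_refl H)); lia.
case.
  case=> [[[H h1 h2]|[H h1 h2]]|[-> -> -> ->]]; apply: ttp_lower => //; try lia.
  - by apply: (uw_eq (uw_rot (uw_rot H))); lia.
  - by apply: (uw_eq (uw_rot (uw_rot (uw_rot H)))); lia.
  - by have [w Hw ew] := uw_on_axis n.+1; apply: (uw_eq (uw_refl Hw)); lia.
case=> -[H h1 h2].
  by apply: (ttp_eq (ttp_right H _ _)); lia.
by apply: (ttp_eq (ttp_left (uw_refl H) _ _)); lia.
Qed.

Lemma has_card_tau n k : has_card (placed n) k -> tau n.+1 = k.
Proof. by move=> [l [h1 <- h2]]; apply: tauE. Qed.

Theorem theorem10 :
  [/\ tau 1 = 1%N,
      tau 2 = 3%N
    & forall n : nat, (3 <= n)%N ->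
        (tau n)%:R = 2 / 3 * (3 ^+ wt (n - 1) + 3 ^+ wt (n - 2)) + 1 :> rat].
Proof.
split.
- by rewrite /tau fsetD0 cardfs1.
- by rewrite (has_card_tau (card_placed 0)) (wt_doubleS 0) /wt big_ord0.
case=> [|[|n]] // n3; rewrite (has_card_tau (card_placed n)) subn1 subn2 /=.
(* From stage 3 on both weights are positive, so the divisions by 3 are exact. *)
have w1 := @wt_gt0 n.+1 isT; have w0 : (0 < wt n)%N by apply: wt_gt0; lia.
rewrite -(prednK w1) -(prednK w0) !expnS !mulKn // !exprS !natrD !natrX.
by field.
Qed.
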